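(* Let $X$ be an infinite set and let $G,H\leq \mathrm{Sym}(X)$ be closed permutation groups on $X$ with $H\leq G$. Suppose that $G$ and $H$ are orbit-equivalent, and that $G$ is primitive on $X$ but not $2$-transitive on $X$. Then $H=G$.
   Context: A permutation group on $X$ is a subgroup of $\mathrm{Sym}(X)$. It is closed if it is a closed subset of $\mathrm{Sym}(X)$ in the topology of pointwise convergence with respect to the discrete topology on $X$ (the basic open sets are the cosets of pointwise stabilisers of finite subsets of $X$). For a positive integer $k$, $X^{[k]}$ denotes the collection of unordered $k$-element subsets of $X$. Two permutation groups $G,H$ on $X$ are orbit-equivalent if for every positive integer $k$ they have the same orbits on $X^{[k]}$. $G$ is primitive on $X$ if it preserves no proper non-trivial equivalence relation on $X$ (i.e. the only $G$-invariant equivalence relations on $X$ are equality and the universal relation). $G$ is $2$-transitive if it is transitive on ordered pairs of distinct elements of $X$. The set $X$ is not assumed to be countable. *)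

(* Defs.v *)
From HB Require Import structures.
From mathcomp Require Import all_boot finmap.
From mathcomp Require Import all_classical.
From mathcomp Require Import topology.

Set Implicit Arguments.
Unset Strict Implicit.
Unset Printing Implicit Defensive.

Local Open Scope classical_set_scope.

(* As the type of the elements of a set of [{ptws X -> discrete_topology X}],
   [Sym X] carries the subset topology of the topology of pointwise
   convergence, with [X] discrete. *)
Definition Sym (X : choiceType) : Type :=
  [set f : {ptws X -> discrete_topology X} | bijective (f : X -> X)].

HB.instance Definition _ (X : choiceType) := Topological.on (Sym X).

Definition Sym_fun (X : choiceType) (g : Sym X) : X -> X := \val g.
Coercion Sym_fun : Sym >-> Funclass.

Section SymGroup.
Variable X : choiceType.
Implicit Types g h : Sym X.

Lemma Sym_bij g : bijective g.
Proof. exact: (set_valP g). Qed.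

Definition Sym_of (f : X -> X) (fbij : bijective f) : Sym X :=
  exist _ (f : {ptws X -> discrete_topology X}) (mem_set fbij).

Lemma Sym_ofE f (fbij : bijective f) : Sym_of fbij = f :> (X -> X).
Proof. by []. Qed.

Lemma Sym_ext g h : g =1 h -> g = h.
Proof. by move=> gh; apply: val_inj; apply/funext. Qed.

Lemma Sym_inverse g :
  exists f : X -> X, cancel g f /\ cancel f g.
Proof. by have [f gK fK] := Sym_bij g; exists f. Qed.

Definition Sym_inv_fun g : X -> X := sval (cid (Sym_inverse g)).

Lemma Sym_funK g : cancel g (Sym_inv_fun g).
Proof. exact: (svalP (cid (Sym_inverse g))).1. Qed.

Lemma Sym_funVK g : cancel (Sym_inv_fun g) g.
Proof. exact: (svalP (cid (Sym_inverse g))).2. Qed.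

Definition Sym_one : Sym X := Sym_of (inv_bij (frefl id : involutive id)).

Definition Sym_inv g : Sym X := Sym_of (Bijective (Sym_funVK g) (Sym_funK g)).

Definition Sym_mul g h : Sym X := Sym_of (bij_comp (Sym_bij g) (Sym_bij h)).

Lemma Sym_mulA : associative Sym_mul.
Proof. by move=> g h k; apply: Sym_ext. Qed.

Lemma Sym_mul1 : left_id Sym_one Sym_mul.
Proof. by move=> g; apply: Sym_ext. Qed.

Lemma Sym_1mul : right_id Sym_one Sym_mul.
Proof. by move=> g; apply: Sym_ext. Qed.

Lemma Sym_mulV : left_inverse Sym_one Sym_inv Sym_mul.
Proof. by move=> g; apply: Sym_ext => x; exact: Sym_funK. Qed.

Lemma Sym_Vmul : right_inverse Sym_one Sym_inv Sym_mul.
Proof. by move=> g; apply: Sym_ext => x; exact: Sym_funVK. Qed.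

HB.instance Definition _ := isGroup.Build (Sym X)
  Sym_mulA Sym_mul1 Sym_1mul Sym_mulV Sym_Vmul.

End SymGroup.

Section PermutationGroups.
Variable X : choiceType.
Implicit Types (G H : set (Sym X)) (A : {fset X}).

Definition permutation_group G : Prop := group_closed [in G].

Definition ksubsets (k : nat) : set {fset X} := [set A | #|` A|%fset = k].

Definition orbit_of G A : set {fset X} := [set [fset g x | x in A]%fset | g in G].

Definition orbits_on_ksubsets G (k : nat) : set (set {fset X}) :=
  [set orbit_of G A | A in ksubsets k].

Definition orbit_equivalent G H : Prop :=
  forall k, (0 < k)%N -> orbits_on_ksubsets G k = orbits_on_ksubsets H k.

Definition invariant_relation G (R : X -> X -> Prop) : Prop :=
  forall g, G g -> forall x y, R x y <-> R (g x) (g y).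

Definition primitive G : Prop :=
  forall R : X -> X -> Prop,
    RelationClasses.Equivalence R -> invariant_relation G R ->
    (forall x y, R x y <-> x = y) \/ (forall x y, R x y).

Definition two_transitive G : Prop :=
  forall x1 x2 y1 y2 : X, x1 <> x2 -> y1 <> y2 ->
    exists2 g, G g & g x1 = y1 /\ g x2 = y2.

End PermutationGroups.

(* Main.v *)
Require Import Defs.
From mathcomp Require Import all_boot finmap.
From mathcomp Require Import all_classical.
From mathcomp Require Import topology.
From mathcomp Require Import zify.

(* It suffices to put every finite set A inside a finite set F such that each
   element of G stabilising F setwise fixes A pointwise: given g in G, some h
   in H has h F = g F, so h agrees with g on A, and H is closed.

   If G is 2-homogeneous, it preserves a tournament. By primitivity any two
   points are related differently to infinitely many points. Adjoin to a finite
   set E a transitive chain, longer than E, of points related to E in the same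
   way; out-degrees show that the chain is fixed pointwise by the stabiliser.

   Otherwise G preserves a graph that is neither null nor complete. Suppose
   first that any two neighbourhoods differ by a finite set. Then some orbital
   graph has infinite diameter, in its metric any two points of A have
   different distances to points arbitrarily far away, and such a far point is
   fixed by the stabiliser of A together with it.

   Suppose finally that any two neighbourhoods differ by an infinite set, and
   view points as elements of the Cantor space 2^X through their
   neighbourhoods. Nonprincipal ultrafilters U_i yield blocks of pairwise
   twins, whose sizes can be chosen so that all twin classes of blocks are
   preserved. If the points are isolated, the blocks come from ultrafilters
   separating A from a finite set E that isolates the points of A from the
   blocks. If not, they consist of points close to the elements of a finite
   set C that separates A and has no twin of a point of A. *)

Set Implicit Arguments.
Unset Strict Implicit.
Unset Printing Implicit Defensive.

(** * Reduction to a rigidity property *)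

Section PermutationGroupTheory.
Local Open Scope classical_set_scope.
Local Open Scope fset_scope.
Variable X : choiceType.
Implicit Types (G H : set (Sym X)) (g h : Sym X) (A E F : {fset X}).

Lemma pgroup1 G : permutation_group G -> G (Sym_one X).
Proof. by case=> + _; rewrite inE. Qed.

Lemma pgroupV G g : permutation_group G -> G g -> G (Sym_inv g).
Proof.
by move=> /group_closedV clV Gg; have := clV g; rewrite !inE => /(_ Gg).
Qed.

Lemma pgroupM G g h :
  permutation_group G -> G g -> G h -> G (Sym_mul g h).
Proof.
move=> /group_closedM clM Gg Gh.
by have := clM g h; rewrite !inE => /(_ Gg Gh).
Qed.

Lemma Sym_inj g : injective g.
Proof. exact: bij_inj (Sym_bij g). Qed.

Lemma Sym_invK g : cancel g (Sym_inv g).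
Proof. exact: Sym_funK. Qed.

Lemma Sym_invVK g : cancel (Sym_inv g) g.
Proof. exact: Sym_funVK. Qed.

(** The sets of elements of [H] agreeing with [g] on a finite set generate a proper filter that
    converges to [g]. *)
Lemma closed_approx H g :
  closed H -> (forall A, exists2 h, H h & {in A, h =1 g}) -> H g.
Proof.
move=> clH apx; apply: clH.
pose Phi : set_system (Sym X) := filter_from [set: {fset X}]
  (fun A => [set h | H h /\ {in A, h =1 g}]).
have PhiF : ProperFilter Phi.
  apply: filter_from_proper; first last.
    by move=> A _; have [h Hh hA] := apx A; exists h.
  apply: filter_from_filter; first by exists fset0.
  move=> A B _ _; exists (A `|` B) => // h [Hh hAB].
  by split; split=> // x xA; apply: hAB; rewrite inE xA ?orbT.
suff Phig : Phi --> g.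
  move=> B /Phig [A _ AB]; have [h Hh hA] := apx A.
  by exists h; split=> //; apply: AB.
move=> B [_ [[V oV <-] Vg /filterS]]; apply.
(* The topology is induced from the product, so convergence is checked at one point [x] at a time,
   with [A] the singleton of [x]. *)
have ptw : (set_val @ Phi) --> (set_val g : {ptws X -> discrete_topology X}).
  rewrite cvg_sup => x.
  rewrite cvg_image; last by rewrite eqEsubset; split=> v // _; exists (cst v).
  move=> W /nbhs_singleton Wg; exists (@^~ x @^-1` W); last first.
    by rewrite eqEsubset; split => [_ [f Wf <-//]|v Wv]; exists (cst v).
  exists [fset x] => // h [_ hx].
  have hgx : set_val h x = set_val g x by apply: hx; rewrite inE.
  by rewrite /preimage/= hgx.
apply: ptw; exact: open_nbhs_nbhs.
Qed.

Lemma orbit_equivalent_img G H g F :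
  permutation_group G -> permutation_group H -> orbit_equivalent G H -> G g ->
  exists2 h, H h & h @` F = g @` F.
Proof.
move=> pG pH GH Gg.
(* Orbit-equivalence concerns positive sizes only, so the empty set is treated apart. *)
have [/eqP F0|F0] := boolP (#|` F| == 0).
  exists (Sym_one X); first exact: pgroup1.
  by move/eqP: F0; rewrite cardfs_eq0 => /eqP ->; rewrite !imfset0.
(* The [G]-orbit of [F] is the [H]-orbit of some [F']. It contains [F] and its image under [g], and
   [H] connects the two through [F']. *)
have : orbits_on_ksubsets G #|` F| (orbit_of G F) by exists F.
rewrite GH ?lt0n// => -[F' _ FF'].
have : orbit_of G F F.
  exists (Sym_one X); first exact: pgroup1.
  by apply/fsetP => x; apply/imfsetP/idP => [[y yF ->//]|xF]; exists x.
have : orbit_of G F (g @` F) by exists g.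
rewrite -FF' => -[h Hh hF'] [h' Hh' h'F'].
exists (Sym_mul h (Sym_inv h')); first by apply: pgroupM => //; exact: pgroupV.
rewrite -hF' -[in LHS]h'F'; apply/fsetP => x.
apply/imfsetP/imfsetP => /= [[_ /imfsetP[y /= yF' ->] ->]|[y yF' ->]].
  by exists y => //=; rewrite /Sym_mul /Sym_fun/= Sym_funK.
exists (h' y); first by apply/imfsetP; exists y.
by rewrite /Sym_mul /Sym_fun/= Sym_funK.
Qed.

Definition locally_rigid G := forall A, exists2 F, A `<=` F &
  forall g, G g -> g @` F = F -> {in A, g =1 id}.

Lemma locally_rigid_eq G H :
  permutation_group G -> permutation_group H -> closed H ->
  (H `<=` G)%classic -> orbit_equivalent G H -> locally_rigid G -> H = G.
Proof.
move=> pG pH clH HG GH rigid; rewrite eqEsubset; split=> // g Gg.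
apply: closed_approx => // A; have [F AF rigF] := rigid A.
have [h Hh hF] := orbit_equivalent_img F pG pH GH Gg; exists h => // x xA.
have /rigF : G (Sym_mul (Sym_inv g) h).
  by apply: pgroupM (HG _ Hh) => //; exact: pgroupV.
move=> /(_ _ x xA) ghx.
apply: (can_inj (Sym_invK (Sym_inv g))).
rewrite [RHS]Sym_invK; apply: ghx.
transitivity (Sym_inv g @` (h @` F)).
  apply/fsetP => y.
  apply/imfsetP/imfsetP => /= [[z zF ->]|[_ /imfsetP[z /= zF ->] ->]].
    by exists (h z) => //; apply/imfsetP; exists z.
  by exists z.
rewrite hF; apply/fsetP => y.
apply/imfsetP/idP => /= [[_ /imfsetP[z /= zF ->] ->]|yF].
  by rewrite Sym_invK.
by exists (g y); [apply/imfsetP; exists y | rewrite Sym_invK].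
Qed.

End PermutationGroupTheory.

(** * Separation and ultrafilters *)

Section InvariantRelations.
Local Open Scope classical_set_scope.
Local Open Scope fset_scope.
Variable X : choiceType.
Implicit Types (G : set (Sym X)) (g h : Sym X) (A E F : {fset X}).
Implicit Types (R : rel X) (U V : set_system X).

Lemma infinite_fresh (S : set X) A :
  infinite_set S -> exists2 x, S x & x \notin A.
Proof.
move=> infS; apply: contrapT => noS; apply: infS.
apply: (@sub_finite_set _ _ [set` A]) => [x Sx /=|]; last exact: finite_fset.
by apply: contrapT => /negP xA; apply: noS; exists x.
Qed.

(** The ordered pairs are excluded one after another. The stabiliser of each larger set preserves
    the previous set, so earlier exclusions persist; at the end [A] is preserved and none of its
    points moves to another. *)
Lemma locally_rigid_stepwise G :
  (forall E a a', a \in E -> a' \in E -> a != a' -> exists2 F, E `<=` F &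
     forall g, G g -> g @` F = F -> g @` E = E /\ g a != a') ->
  locally_rigid G.
Proof.
move=> step A.
have pairs (L : seq (X * X)) : (forall p, p \in L -> p.1 \in A /\ p.2 \in A) ->
    exists2 F, A `<=` F & forall g, G g -> g @` F = F ->
      g @` A = A /\ forall p, p \in L -> p.1 != p.2 -> g p.1 != p.2.
  elim: L => [|[b b'] L IH] sL; first by exists A.
  have {IH}[F AF rigF] := IH (fun p pL => sL p (mem_behead (s := _ :: L) pL)).
  have [/= bA b'A] := sL (b, b') (mem_head _ _).
  have [<-|bb'] := eqVneq b b'.
    exists F => // g Gg gF; have [gA gL] := rigF g Gg gF; split=> // p.
    by rewrite in_cons => /orP[/eqP ->|/gL//]; rewrite eqxx.
  have [F' FF' rigF'] := step F b b' (fsubsetP AF _ bA) (fsubsetP AF _ b'A) bb'.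
  exists F'; first exact: fsubset_trans AF FF'.
  move=> g Gg gF'; have [gF gb] := rigF' g Gg gF'.
  have [gA gL] := rigF g Gg gF; split=> // p.
  by rewrite in_cons => /orP[/eqP ->|/gL].
have [|F AF rigF] := pairs [seq (a, a') | a <- enum_fset A, a' <- enum_fset A].
  by move=> _ /allpairsP[[x y] /= [xA yA ->]].
exists F => // g Gg gF x xA; have [gA gL] := rigF g Gg gF.
apply/eqP; apply: contraTT xA => gx; apply: contraT; rewrite negbK => xA.
have gxA : g x \in A by rewrite -gA; apply/imfsetP; exists x.
by have /gL := allpairs_f pair xA gxA; rewrite /= eq_sym gx eqxx => /(_ isT).
Qed.

(** The orbit relation is invariant. If it were equality, [G] would fix every point and preserve the
    partition into [x] and the rest, which is non-trivial as [X] has at least three points. *)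
Lemma primitive_transitive G x y : infinite_set [set: X] ->
  permutation_group G -> primitive G -> exists2 g, G g & g x = y.
Proof.
move=> infX pG prim.
pose T u v := exists2 g, G g & g u = v.
have eqT : RelationClasses.Equivalence T.
  split=> [u|u _ [g Gg <-]|u _ _ [g Gg <-] [h Gh <-]].
  - by exists (Sym_one X) => //; exact: pgroup1.
  - by exists (Sym_inv g); [exact: pgroupV | rewrite Sym_invK].
  - by exists (Sym_mul h g) => //; exact: pgroupM.
have invT : invariant_relation G T.
  move=> g Gg u v; split=> [[h Gh <-]|[h Gh hg]].
    exists (Sym_mul g (Sym_mul h (Sym_inv g))).
      by do 2?apply: pgroupM => //; exact: pgroupV.
    by rewrite /Sym_mul /Sym_fun/= Sym_funK.
  exists (Sym_mul (Sym_inv g) (Sym_mul h g)).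
    by do 2?apply: pgroupM => //; exact: pgroupV.
  by rewrite -[RHS](Sym_invK g) -hg.
case: (prim T eqT invT) => [Teq|]; last exact.
have Gid g u : G g -> g u = u by move=> Gg; apply/esym/Teq; exists g.
pose T' (u v : X) := (u = x) <-> (v = x).
have eqT' : RelationClasses.Equivalence T' by split=> [u|u v|u v w]; rewrite /T'; tauto.
have invT' : invariant_relation G T' by move=> g Gg u v; rewrite !Gid.
have [u _ ux] := infinite_fresh [fset x] infX.
have [v _ vux] := infinite_fresh [fset x; u] infX.
move: ux vux; rewrite !inE => /eqP ux /norP[/eqP vx /eqP vu].
case: (prim T' eqT' invT') => [T'eq|T'all]; last first.
  by case: (T'all x u) => + _ => /(_ erefl).
by case: vu; apply/T'eq; rewrite /T'; split.
Qed.

Definition rel_invariant G R :=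
  forall g, G g -> forall x y, R (g x) (g y) = R x y.

Definition sepset R a b : set X := [set x | R x a != R x b].

Lemma sepset_sym R a b : sepset R a b = sepset R b a.
Proof. by apply/seteqP; split=> x; rewrite /sepset/= eq_sym. Qed.

Lemma sepset_trans R a b c :
  (sepset R a c `<=` sepset R a b `|` sepset R b c)%classic.
Proof.
by move=> x; rewrite /sepset/=; case: (R x a) (R x b) (R x c) => [] [] [] //= _;
  [right|left|left|right].
Qed.

Lemma sepset_img G R g a b : permutation_group G -> rel_invariant G R -> G g ->
  sepset R (g a) (g b) = [set g x | x in sepset R a b].
Proof.
move=> pG invR Gg; apply/seteqP; split=> [x|_ [x /= xs <-]].
  rewrite /sepset/= => xs; exists (Sym_inv g x); last exact: Sym_invVK.
  by rewrite /= -(invR g Gg _ a) -(invR g Gg _ b) Sym_invVK.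
by rewrite /sepset/= !invR.
Qed.

(** Having a finite separating set is an invariant equivalence relation. *)
Lemma sepset_dichotomy G R :
  permutation_group G -> primitive G -> rel_invariant G R ->
  (forall a b, a != b -> infinite_set (sepset R a b)) \/
  (forall a b, finite_set (sepset R a b)).
Proof.
move=> pG prim invR; pose T a b := finite_set (sepset R a b).
have eqT : RelationClasses.Equivalence T.
  split=> [a|a b|a b c].
  - rewrite /T; have -> : sepset R a a = set0; last exact: finite_set0.
    by apply/seteqP; split=> x; rewrite /sepset//= eqxx.
  - by rewrite /T sepset_sym.
  - move=> ab bc; apply: (sub_finite_set (@sepset_trans R a b c)).
    by rewrite finite_setU; split.
have invT : invariant_relation G T.
  have Timg g a b : G g -> T a b -> T (g a) (g b).
    by move=> Gg; rewrite /T (sepset_img _ _ pG invR Gg) => /finite_image; apply.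
  move=> g Gg a b; split; first exact: Timg.
  by move=> /(Timg _ _ _ (pgroupV pG Gg)); rewrite !Sym_invK.
case: (prim T eqT invT) => [Teq|Tall]; [left|right => //].
by move=> a b /eqP ab /Teq.
Qed.

(** For an ultrafilter, containing all cofinite sets is nonprincipality. *)
Definition free_ultra U := UltraFilter U /\ forall A, U [set x | x \notin A].

Lemma free_ultra_infinite (S : set X) : infinite_set S ->
  exists2 U, free_ultra U & U S.
Proof.
move=> infS.
pose Phi : set_system X :=
  filter_from [set: {fset X}] (fun A => [set x | S x /\ x \notin A]).
have PhiF : ProperFilter Phi.
  apply: filter_from_proper; first last.
    by move=> A _; have [x] := infinite_fresh A infS; exists x.
  apply: filter_from_filter; first by exists fset0.
  move=> A B _ _; exists (A `|` B) => // x [Sx].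
  by rewrite inE negb_or => /andP[].
have [U [ultU PhiU]] := ultraFilterLemma PhiF.
exists U; first split=> //.
  by move=> A; apply: PhiU; exists A => // x [].
by apply: PhiU; exists fset0 => // x [].
Qed.

(** The limit of a two-valued function along an ultrafilter [U]; the function takes this value on a
    member of [U]. *)
Definition ulim U (p : X -> bool) : bool := `[< U [set x | p x] >].

(* The neighbourhood of the limit of [U] in the Cantor space over [X]. *)
Definition xi R U w := ulim U (fun x => R x w).

Lemma ulimP U p : UltraFilter U -> U [set x | p x = ulim U p].
Proof.
move=> ultU; have ? := @ultra_proper _ _ ultU; rewrite /ulim.
case: asboolP => [Up|nUp].
  by apply: filterS Up => x /= ->.
case: (in_ultra_setVsetC [set x | p x] ultU) => // Up.
by apply: filterS Up => x /= /negP/negbTE.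
Qed.

Lemma ulim_eq U p b : UltraFilter U -> U [set x | p x = b] -> ulim U p = b.
Proof.
move=> ultU Ub; have ? := @ultra_proper _ _ ultU.
by have [x [/= <- ->]] := filter_ex (filterI Ub (ulimP p ultU)).
Qed.

Lemma xi_sepset R U a b :
  UltraFilter U -> U (sepset R a b) -> xi R U a != xi R U b.
Proof.
move=> ultU Uab; have PU := @ultra_proper _ _ ultU.
have FU : Filter U by exact: _.
have UI := @filterI _ U FU.
have Ub := UI _ _ (UI _ _ Uab (ulimP (fun x => R x a) ultU))
  (ulimP (fun x => R x b) ultU).
by have [x [[+ /= xa] xb]] := filter_ex Ub; rewrite /sepset/= xa xb.
Qed.

Lemma filter_seq (I : eqType) U (s : seq I) (Q : I -> set X) : Filter U ->
  (forall w, w \in s -> U (Q w)) -> U [set x | forall w, w \in s -> Q w x].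
Proof.
move=> FU; elim: s => [|v s IH] Us; first exact: filterS filterT.
apply: filterS (filterI (Us v (mem_head _ _)) (IH _)) => [x /= [vx sx] w|w ws].
  by rewrite in_cons => /orP[/eqP ->|/sx].
by apply: Us; rewrite in_cons ws orbT.
Qed.

(** Each new point goes to the head of the list and is generic for [U] over [W] and the points
    chosen before. Those points [y] have [xi R U y] equal to the iterated limit, which thus becomes
    the relation of the new point to them. *)
Lemma ultra_chain R U (W : {fset X}) (P : set X) n : free_ultra U -> U P ->
  exists s : seq X, [/\ uniq s, size s = n,
    forall x, x \in s ->
      [/\ x \notin W, P x, xi R U x = ulim U (xi R U)
        & forall w, w \in W -> R x w = xi R U w]
    & pairwise (fun x y => R x y == ulim U (xi R U)) s].
Proof.
move=> [ultU freeU] UP; have PU := @ultra_proper _ _ ultU.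
have FU : Filter U by exact: _.
elim: n => [|n [s [us sz sP pw]]].
  by exists [::].
have Uxi w : U [set x | R x w = xi R U w] by exact: ulimP.
have UI := @filterI _ U FU.
have Us := UI _ _ (UI _ _ (UI _ _ UP (freeU (W `|` seq_fset tt s)))
  (ulimP (xi R U) ultU)) (@filter_seq X U (enum_fset W ++ s) _ FU (fun w _ => Uxi w)).
have [x [[[Px xWs] xix] Rx]] := filter_ex Us.
have /andP[xW xs] : (x \notin W) && (x \notin s).
  by rewrite -negb_or -(seq_fsetE tt s) -in_fsetU.
exists (x :: s); split=> /=; rewrite ?sz ?us ?andbT //.
- move=> y; rewrite in_cons => /orP[/eqP ->|/sP//]; split=> // w wW.
  by apply: Rx; rewrite mem_cat wW.
rewrite pw andbT; apply/allP => y ys; have [_ _ <- _] := sP y ys.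
by rewrite Rx// mem_cat ys orbT.
Qed.

End InvariantRelations.

(** * Tournaments *)

Section Automorphisms.
Local Open Scope fset_scope.
Variables (X : choiceType) (g : Sym X) (F : {fset X}).
Hypothesis gF : g @` F = F.

Lemma setwise_stable x : (g x \in F) = (x \in F).
Proof.
rewrite -{1}gF; apply/imfsetP/idP => /= [[y yF /Sym_inj ->//]|xF].
by exists x.
Qed.

Lemma setwise_preim y : y \in F -> exists2 x, x \in F & y = g x.
Proof. by rewrite -{1}gF => /imfsetP[x]; exists x. Qed.

Lemma card_filter_stable (p q : X -> bool) :
  (forall x, x \in F -> q (g x) = p x) ->
  #|` [fset x in F | q x]| = #|` [fset x in F | p x]|.
Proof.
move=> qp; have -> : [fset x in F | q x] = g @` [fset x in F | p x].
  apply/fsetP => y; apply/idP/imfsetP => /= [|[x]].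
    rewrite !inE => /andP[/setwise_preim[x xF ->] qx]; exists x => //.
    by rewrite !inE xF -qp.
  by rewrite !inE => /andP[xF px] ->; rewrite setwise_stable xF qp.
by rewrite card_imfset //; exact: Sym_inj.
Qed.

End Automorphisms.

Section Tournaments.
Local Open Scope fset_scope.
Variable X : choiceType.
Implicit Types (R : rel X) (E F : {fset X}) (g : Sym X) (s : seq X).

Lemma pairwise_rev (T : Type) (r : rel T) (t : seq T) :
  pairwise r (rev t) = pairwise (fun x y => r y x) t.
Proof.
by elim: t => //= x t IH; rewrite rev_cons pairwise_rcons IH all_rev.
Qed.

(** If [g c] is not [c], then [R b c] gives [R b (g c)], hence [R c (g c)]. For [w] with [g w = c],
    also [R (g c) c = R c w = R b w = R b c], against antisymmetry. *)
Lemma twin_successor_fixed R F g b c :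
  antisymmetric R -> irreflexive R ->
  g @` F = F -> (forall x y, R (g x) (g y) = R x y) ->
  b \in F -> c \in F -> R b c ->
  (forall w, w \in F -> w != b -> w != c -> R b w = R c w) ->
  g b = b -> R b (g c) = R c (g c) -> g c = c.
Proof.
move=> asymR irrR gF gR bF cF Rbc tw gb Rgc; apply/eqP.
apply: contraT => gcc; have bc : b != c.
  by apply: contraTneq Rbc => ->; rewrite irrR.
have Rcgc : R c (g c) by rewrite -Rgc -{1}gb gR.
suff Rgcc : R (g c) c.
  by rewrite -(asymR _ _ (introT andP (conj Rcgc Rgcc))) eqxx in gcc.
have [w wF cw] := setwise_preim gF cF.
rewrite {2}cw gR -tw//; first by rewrite -gR gb -cw.
- by apply: contra_neq bc => wb; rewrite cw wb gb.
- by apply: contra_neq gcc => wc; rewrite {2}cw wc.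
Qed.


(** Out-degrees in [F] strictly decrease along the chain, so a chain point mapped into the chain is
    fixed. Some point is, and since consecutive chain points are twins in [F], being fixed spreads
    in both directions. *)
Lemma chain_fixed R E F s g :
  (forall x, (x \in F) = (x \in E) || (x \in s)) ->
  antisymmetric R -> irreflexive R -> uniq s -> pairwise R s ->
  (forall x y, x != y -> R x y || R y x) ->
  (#|` E| < size s)%N -> {in s, forall x, x \notin E} ->
  {in s &, forall x y, {in E, forall w, R x w = R y w}} ->
  (forall x y, R (g x) (g y) = R x y) ->
  g @` F = F -> {in s, forall x, g x = x}.
Proof.
move=> FE asymR irrR us pw totR Es sE sw gR gF.
have nR x y : R x y -> R y x = false.
  move=> Rxy; apply/negP => Ryx; have xy := asymR _ _ (introT andP (conj Rxy Ryx)).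
  by rewrite xy irrR in Rxy.
case: s => [|x0 s'] in us pw Es sE sw FE *; first by [].
set s := x0 :: s' in us pw Es sE sw FE *.
have lts i j : (i < size s)%N -> (j < size s)%N -> (i < j)%N ->
    R (nth x0 s i) (nth x0 s j).
  by move=> si sj; have /pairwiseP := pw; apply.
have sF i : (i < size s)%N -> nth x0 s i \in F.
  by move=> si; rewrite FE mem_nth ?orbT.
pose deg x := #|` [fset y in F | R x y]|.
have degg x : deg (g x) = deg x by apply: (card_filter_stable gF) => y _; exact: gR.
have degs i j : (i < size s)%N -> (j < size s)%N -> (i < j)%N ->
    (deg (nth x0 s j) < deg (nth x0 s i))%N.
  move=> si sj ij; apply: fproper_ltn_card; rewrite fproperE; apply/andP; split.
    apply/fsubsetP => w; rewrite !inE => /andP[wF Rw]; rewrite wF/=.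
    move: wF; rewrite FE => /orP[wE|ws].
      by rewrite (sw _ (nth x0 s j)) ?mem_nth.
    move: Rw; rewrite -(nth_index x0 ws); move: (ws); rewrite -index_mem => sk.
    have [jk|kj|-> ] := ltngtP j (index w s).
    - by move=> _; apply: lts => //; exact: ltn_trans jk.
    - by rewrite nR//; exact: lts.
    - by rewrite irrR.
  apply/fsubsetPn; exists (nth x0 s j); rewrite !inE sF //= ?irrR //.
  exact: lts.
have fix1 x : x \in s -> g x \in s -> g x = x.
  move=> xs gxs; have := degg x; move: xs gxs.
  move=> /(nthP x0)[i si <-] /(nthP x0)[j sj <-].
  have [ij|ji|->//] := ltngtP i j.
  - by move=> dd; have := degs _ _ si sj ij; rewrite dd ltnn.
  - by move=> dd; have := degs _ _ sj si ji; rewrite dd ltnn.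
(* As [E] has fewer points than the chain, [g] cannot map the whole chain into [E]. *)
have [i0 si0 gi0] : exists2 i, (i < size s)%N & g (nth x0 s i) = nth x0 s i.
  have [/hasP[x xs gxs]|/hasPn nos] := boolP (has (fun x => g x \in s) s).
    by exists (index x s); rewrite ?index_mem// nth_index// fix1.
  have : (size (map g s) <= size (enum_fset E))%N.
    apply: uniq_leq_size => [|_ /mapP[x xs ->]].
      by rewrite map_inj_uniq//; exact: Sym_inj.
    have : g x \in F by rewrite (setwise_stable gF) FE xs orbT.
    by rewrite FE (negbTE (nos x xs)) orbF.
  by rewrite size_map leqNgt Es.
have fixS i : (i.+1 < size s)%N ->
    g (nth x0 s i) = nth x0 s i <-> g (nth x0 s i.+1) = nth x0 s i.+1.
  move=> si1; have si := ltnW si1; have Ri := lts i i.+1 si si1 (ltnSn i).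
  have tw w : w \in F -> w != nth x0 s i -> w != nth x0 s i.+1 ->
      R (nth x0 s i) w = R (nth x0 s i.+1) w.
    rewrite FE => /orP[wE _ _|ws]; first by apply: sw => //; exact: mem_nth.
    rewrite -(nth_index x0 ws); move: (ws); rewrite -index_mem => sk.
    rewrite !nth_uniq// => ki ki1.
    have [k|k] : (index w s < i \/ i.+1 < index w s)%N by lia.
      rewrite (nR _ _ (lts _ _ sk si k)) (nR _ _ (lts _ _ sk si1 _))//.
      exact: ltnW.
    by rewrite (lts _ _ si1 sk k) (lts _ _ si sk)//; exact: ltnW.
  have inE_or x : x \in s -> g x \in E \/ g x = x.
    move=> xs; have : g x \in F by rewrite (setwise_stable gF) FE xs orbT.
    by rewrite FE => /orP[|/(fix1 x xs)]; [left|right].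
  split=> [gi|gi1].
    have [gE|//] := inE_or _ (mem_nth x0 si1).
    apply: (twin_successor_fixed asymR irrR gF gR _ _ Ri tw gi); rewrite ?sF//.
    by apply: sw => //; exact: mem_nth.
  have [gE|//] := inE_or _ (mem_nth x0 si).
  (* Backwards, the same argument runs in the reversed tournament. *)
  pose R' : rel X := fun x y => R y x.
  have totE x y : x != y -> R x y = ~~ R y x.
    by move=> /totR /orP[] Rxy; rewrite ?Rxy (nR _ _ Rxy).
  apply: (@twin_successor_fixed R' F g _ _ _ irrR gF _
    (sF _ si1) (sF _ si) Ri _ gi1) => //.
  - by move=> x y; rewrite /R' andbC => /asymR.
  - by move=> x y; exact: gR.
  - move=> w wF wi1 wi; rewrite /R' totE// [RHS]totE// tw//.
  - by rewrite /R' totE 1?[RHS]totE 1?(sw _ (nth x0 s i)) ?mem_nth//;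
      apply: contraTneq gE => ->; apply: sE; exact: mem_nth.
have all0 i : (i < size s)%N -> g (nth x0 s i) = nth x0 s i <-> g x0 = x0.
  elim: i => [//|i IH] si; rewrite -fixS//; apply: IH; exact: ltnW.
have g0 : g x0 = x0 by apply/(all0 i0).
by move=> x xs; rewrite -(nth_index x0 xs); apply/all0; rewrite ?index_mem.
Qed.

(** * 2-homogeneous groups preserving a tournament *)

Section TwoHomogeneous.
Variables (G : set (Sym X)) (R : rel X).
Hypotheses (infX : infinite_set [set: X]%classic) (pG : permutation_group G).
Hypotheses (prim : primitive G) (invR : rel_invariant G R).
Hypotheses (irrR : irreflexive R) (asymR : antisymmetric R).
Hypothesis totR : forall x y, x != y -> R x y || R y x.
Hypothesis homG : forall a b c d, a != b -> c != d ->
  exists2 g, G g & (g a = c /\ g b = d) \/ (g a = d /\ g b = c).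

(** If the iterated limit is true, [ultra_chain] gives an [R]-chain; otherwise totality makes its
    reversal one. *)
Lemma transitive_chain U E n : free_ultra U -> exists s : seq X,
  [/\ uniq s, size s = n, {in s, forall x, x \notin E}, pairwise R s
    & {in s, forall x, {in E, forall w, R x w = xi R U w}}].
Proof.
move=> freeU.
have [ultU _] := freeU; have PU := @ultra_proper _ _ ultU.
have UT : U setT by exact: filterT.
have [s [us sz sP pw]] := ultra_chain R E n freeU UT.
have sE x : x \in s -> x \notin E by case/sP.
have sR x : x \in s -> {in E, forall w, R x w = xi R U w} by case/sP.
have [Ul|Ul] := boolP (ulim U (xi R U)); first exists s; last exists (rev s).
  by split=> //; apply: (sub_pairwise _ pw) => x y /eqP ->.
split; rewrite ?rev_uniq ?size_rev//; try by move=> x; rewrite mem_rev; auto.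
rewrite pairwise_rev; move: us; rewrite uniq_pairwise => us.
have : pairwise [rel x y | (x != y) && (R x y == ulim U (xi R U))] s.
  by rewrite pairwise_relI us.
apply: sub_pairwise => x y /= /andP[/totR + /eqP Rxy].
by rewrite Rxy (negbTE Ul).
Qed.

(** If one separating set is finite, 2-homogeneity bounds them all by the same [K]. But the ends of
    a transitive chain are separated by every point between them. *)
Lemma tournament_sepset_infinite a b : a != b -> infinite_set (sepset R a b).
Proof.
move=> ab; have [|fin] := sepset_dichotomy pG prim invR; first exact.
have [U freeU _] := free_ultra_infinite infX.
have [K cardK] : exists K, forall c d, c != d ->
    forall s : seq X, uniq s -> {subset s <= sepset R c d} -> (size s <= K)%N.
  exists #|` fset_set (sepset R a b)| => c d cd s us sS.
  have [g Gg gab] := homG ab cd.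
  have sepE : sepset R c d = [set g x | x in sepset R a b]%classic.
    by rewrite -(sepset_img _ _ pG invR Gg); case: gab => -[-> ->] //; rewrite sepset_sym.
  rewrite -[leqRHS](size_map g); apply: uniq_leq_size => // x /sS.
  rewrite sepE inE => -[y ys <-]; apply: map_f.
  by rewrite in_fset_set// inE.
(* Two ends and [K + 1] points between them. *)
have [[|c s] [us sz _ pw _]] := transitive_chain fset0 K.+3 freeU; first by [].
case/lastP: s => [|s d] in us sz pw *; first by [].
have cd : c != d.
  by move: us => /= /andP[+ _]; rewrite mem_rcons inE negb_or => /andP[].
suff sub : {subset s <= sepset R c d}.
  have us' : uniq s by move: us => /= /andP[_]; rewrite rcons_uniq => /andP[].
  by have := cardK c d cd s us' sub; move: sz; rewrite /= size_rcons; lia.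
move=> x xs; rewrite inE /sepset/=.
move: pw => /= /andP[/allP cs]; rewrite -cats1 pairwise_cat => /and3P[/allrelP sd _ _].
have Rcx : R c x by apply: cs; rewrite mem_rcons inE xs orbT.
have -> : R x d by apply: sd; rewrite ?inE.
apply/negP => /eqP Rxc; have xc := asymR (introT andP (conj Rcx Rxc)).
by move: Rcx; rewrite xc irrR.
Qed.

(** The chain is taken generic for an ultrafilter containing the separating set of [a] and [a']. It
    is fixed pointwise, so [E] is preserved, and any point of the chain tells [a] from [a']. *)
Lemma tournament_locally_rigid : locally_rigid G.
Proof.
apply: locally_rigid_stepwise => E a a' aE a'E aa'.
have [U freeU Usep] := free_ultra_infinite (tournament_sepset_infinite aa').
have [s [us sz sE pw sR]] := transitive_chain E #|` E|.+1 freeU.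
pose F := E `|` seq_fset tt s.
have FE x : (x \in F) = (x \in E) || (x \in s) by rewrite in_fsetU seq_fsetE.
exists F => [|g Gg gF]; first exact: fsubsetUl.
have gs : {in s, forall x, g x = x}.
  apply: (chain_fixed FE asymR irrR us pw totR) gF => //; first by rewrite sz.
  - by move=> x y xs ys w wE; rewrite !sR.
  - exact: invR.
have gE x : (g x \in E) = (x \in E).
  have Fs y : y \in E = (y \in F) && (y \notin s).
    rewrite FE; have [yE|] := boolP (y \in E); last by case: (y \in s).
    by apply/esym; apply: contraL yE; exact: sE.
  rewrite !Fs (setwise_stable gF); congr (_ && ~~ _).
  apply/idP/idP => [gxs|xs]; last by rewrite gs.
  by rewrite -(Sym_inj (gs _ gxs)).
split.
  apply/fsetP => x; apply/imfsetP/idP => /= [[y yE ->]|xE]; first by rewrite gE.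
  exists (Sym_inv g x); last by rewrite Sym_invVK.
  by rewrite -gE Sym_invVK.
case: s => [|x s] in us sz sE pw sR F FE gF gs *; first by [].
apply/eqP => gaa'; have [ultU _] := freeU.
case/eqP: (xi_sepset ultU Usep); rewrite -!(sR x) ?mem_head//.
by rewrite -(invR Gg) gs ?mem_head// gaa'.
Qed.

End TwoHomogeneous.

End Tournaments.

(** * Orbital graphs of infinite diameter *)

Section Balls.
Variables (X : choiceType) (D : rel X).
Hypothesis symD : symmetric D.

Fixpoint gball n x y : Prop :=
  if n is n'.+1 then gball n' x y \/ exists2 z, D x z & gball n' z y else x = y.

Lemma gball_leq m n x y : m <= n -> gball m x y -> gball n x y.
Proof.
by elim: n => [|n IH]; [case: m | rewrite leq_eqVlt => /predU1P[->//|/IH mn /mn]; left].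
Qed.

Lemma gball1 x y : D x y -> gball 1 x y.
Proof. by move=> Dxy; right; exists y. Qed.

Lemma gball_trans m n x y z : gball m x y -> gball n y z -> gball (m + n) x z.
Proof.
elim: m x => [|m IH] x /=; first by move=> ->.
case=> [xy yz|[w Dxw wy] yz]; first by left; exact: IH yz.
by right; exists w => //; exact: IH yz.
Qed.

Lemma gball_sym n x y : gball n x y -> gball n y x.
Proof.
elim: n x => [//|n IH] x /= [/IH|[z Dxz /IH yz]]; first by left.
by have := gball_trans yz (gball1 (etrans (symD _ _) Dxz)); rewrite addn1.
Qed.

Hypothesis conn : forall x y, exists n, gball n x y.

Let conn_ex x y : exists n, `[< gball n x y >].
Proof. by have [n nP] := conn x y; exists n; exact/asboolP. Qed.

Definition dist x y := ex_minn (conn_ex x y).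

Lemma distP n x y : gball n x y <-> dist x y <= n.
Proof.
rewrite /dist; case: ex_minnP => m /asboolP mP min; split.
  by move=> /asboolP/min.
by move=> mn; exact: gball_leq mP.
Qed.

Lemma dist_sym x y : dist x y = dist y x.
Proof.
by apply/eqP; rewrite eqn_leq; apply/andP; split; apply/distP/gball_sym/distP.
Qed.

Lemma dist_triangle x y z : dist x z <= dist x y + dist y z.
Proof. by apply/distP; apply: (@gball_trans _ _ _ y); exact/distP. Qed.

Lemma dist_step x y : 0 < dist x y -> exists2 z, D x z & dist z y < dist x y.
Proof.
case E : (dist x y) => [//|n] _.
have : gball n.+1 x y by apply/distP; rewrite E.
by case=> [/distP|[z Dxz /distP zy]]; [rewrite E ltnn | exists z].
Qed.

End Balls.

Section Orbitals.
Local Open Scope fset_scope.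
Variables (X : choiceType) (G : set (Sym X)).
Hypotheses (infX : infinite_set [set: X]%classic) (pG : permutation_group G).
Hypothesis prim : primitive G.
Implicit Types (g h : Sym X) (a b u v x y z : X).

Definition orbital u v : rel X := fun x y =>
  `[< exists2 g, G g & (g u = x /\ g v = y) \/ (g u = y /\ g v = x) >].

Lemma orbital_refl u v : orbital u v u v.
Proof. by apply/asboolP; exists (Sym_one X); [exact: pgroup1 | left]. Qed.

Lemma orbital_sym u v : symmetric (orbital u v).
Proof.
by move=> x y; apply/asboolP/asboolP => -[g Gg [] ?]; exists g; auto.
Qed.

Lemma rel_invariantW (R : rel X) :
  (forall g, G g -> forall x y, R x y -> R (g x) (g y)) -> rel_invariant G R.
Proof.
move=> RG g Gg x y; apply/idP/idP; last exact: RG.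
by move=> /(RG _ (pgroupV pG Gg)); rewrite !Sym_invK.
Qed.

Lemma orbital_invariant u v : rel_invariant G (orbital u v).
Proof.
apply: rel_invariantW => g Gg x y /asboolP[h Gh huv]; apply/asboolP.
exists (Sym_mul g h); first exact: pgroupM.
by rewrite /Sym_mul/Sym_fun/=; case: huv => -[<- <-]; auto.
Qed.

Lemma gball_invariant (D : rel X) n g x y :
  rel_invariant G D -> G g -> gball D n x y -> gball D n (g x) (g y).
Proof.
move=> invD Gg; elim: n x => [x ->//|n IH] x /= [/IH|[z Dxz /IH]]; first by left.
by right; exists (g z); rewrite ?invD.
Qed.

(** Being joined by a path is an invariant equivalence relation, and it is not equality because [u]
    and [v] are adjacent. *)
Lemma orbital_connected u v x y : u != v -> exists n, gball (orbital u v) n x y.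
Proof.
move=> uv; pose T x y := exists n, gball (orbital u v) n x y.
have eqT : RelationClasses.Equivalence T.
  split=> [a|a b [n ab]|a b c [m ab] [n bc]]; first by exists 0%N.
    by exists n; apply: gball_sym => //; exact: orbital_sym.
  by exists (m + n)%N; exact: gball_trans bc.
have invT : invariant_relation G T.
  have Tg g a b : G g -> T a b -> T (g a) (g b).
    by move=> Gg [n ab]; exists n; apply: gball_invariant => //; exact: orbital_invariant.
  move=> g Gg a b; split; first exact: Tg.
  by move=> /(Tg _ _ _ (pgroupV pG Gg)); rewrite !Sym_invK.
case: (prim eqT invT) => [Teq|]; last exact.
by case/eqP: uv; apply/Teq; exists 1%N; apply: gball1; exact: orbital_refl.
Qed.

Section InfiniteDiameter.
Variables u v : X.
Hypothesis uv : u != v.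
Let D := orbital u v.
Hypothesis unbD : forall n, exists x y, ~ gball D n x y.
Let symD : symmetric D := @orbital_sym u v.
Let d : X -> X -> nat := dist (fun x y => orbital_connected x y uv).

Let dP n x y : gball D n x y <-> (d x y <= n)%N. Proof. exact: distP. Qed.

Let dG g x y : G g -> d (g x) (g y) = d x y.
Proof.
have dG_le h a b : G h -> (d (h a) (h b) <= d a b)%N.
  move=> Gh; apply/dP; apply: gball_invariant => //.
    exact: orbital_invariant.
  exact/dP.
move=> Gg; apply/eqP; rewrite eqn_leq dG_le//=.
by have := dG_le _ (g x) (g y) (pgroupV pG Gg); rewrite !Sym_invK.
Qed.

Let dS x y : d x y = d y x. Proof. exact: dist_sym. Qed.

Let d_tri x y z : (d x z <= d x y + d y z)%N. Proof. exact: dist_triangle. Qed.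

(** Having equal distances to all far points is an invariant equivalence relation. If it were
    universal, it would hold for [u] and [v]; but the first edge of a shortest path between points
    far apart is an image of this pair, and its ends have different distances to the far end. *)
Lemma far_separation a b N : a != b ->
  exists2 z, (N <= d a z)%N & d a z != d b z.
Proof.
move=> ab.
pose T x y := exists N, forall z, (N <= d x z)%N -> d x z = d y z.
have eqT : RelationClasses.Equivalence T.
  split=> [x|x y [n xy]|x y z [m xy] [n yz]]; first by exists 0%N.
    exists (n + d x y)%N => z yz; apply/esym/xy.
    by have := d_tri y x z; rewrite (dS y x); lia.
  exists (m + n)%N => w xw; rewrite xy; last by lia.
  by apply: yz; rewrite -xy; lia.
have Tg g x y : G g -> T x y -> T (g x) (g y).
  move=> Gg [n xy]; exists n => z; rewrite -[z](Sym_invVK g) !(dG _ _ Gg); exact: xy.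
have invT : invariant_relation G T.
  move=> g Gg x y; split; first exact: Tg.
  by move=> /(Tg _ _ _ (pgroupV pG Gg)); rewrite !Sym_invK.
case: (prim eqT invT) => [Teq|Tall].
  apply: contrapT => no; case/eqP: ab; apply/Teq; exists N => z Nz.
  by apply/eqP/negPn/negP => abz; apply: no; exists z.
have [m uvm] := Tall u v; have [n vun] := Tall v u.
have [x [y nxy]] := unbD (m + n).
have dxy : (m + n < d x y)%N by rewrite ltnNge; apply/negP => /dP.
have [z /asboolP[g Gg huv] zy] := dist_step (leq_ltn_trans (leq0n _) dxy).
move: dxy zy; rewrite -[y](Sym_invVK g) -/d.
case: huv => -[<- <-]; rewrite !(dG _ _ Gg) => dxy.
  by rewrite uvm ?ltnn//; lia.
by rewrite vun ?ltnn//; lia.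
Qed.

Lemma infinite_diameter_locally_rigid : locally_rigid G.
Proof.
apply: locally_rigid_stepwise => E a a' aE a'E aa'.
pose K := \max_(x <- enum_fset E) \max_(y <- enum_fset E) d x y.
have KE x y : x \in E -> y \in E -> (d x y <= K)%N.
  move=> xE yE; rewrite /K (big_rem x)//= (big_rem y yE)/=.
  by rewrite !leq_max leqnn.
(* By the triangle inequality, distance above [2K] from [a] leaves distance above [K] from every
   point of [E]. *)
have [z az za] := far_separation (K + K).+1 aa'.
have zE x : x \in E -> (K < d x z)%N.
  by move=> xE; have := d_tri a x z; have := KE a x aE xE; lia.
have zNE : z \notin E by apply/negP => zE'; have := KE _ _ aE zE'; lia.
exists (z |` E) => [|g Gg gF]; first exact: fsubsetU1.
have FE x : (x \in z |` E) = (x == z) || (x \in E) by rewrite in_fset1U.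
(* If [g z] were in [E], another point of [E] would be the image of a point of [E], at distance
   above [K] from [g z]. *)
have gz : g z = z.
  apply: contraTeq isT => gz; have : g z \in z |` E.
    by rewrite (setwise_stable gF) FE eqxx.
  rewrite FE (negbTE gz)/= => gzE.
  have [e eE ee] : exists2 e, e \in E & e != g z.
    by have [agz|] := eqVneq a (g z); [exists a' => //; rewrite -agz eq_sym|exists a].
  have eF : e \in z |` E by rewrite FE eE orbT.
  have [f fF ef] := setwise_preim gF eF.
  have fE : f \in E.
    by move: fF; rewrite FE => /predU1P[fz|//]; rewrite ef fz eqxx in ee.
  by have := KE _ _ eE gzE; rewrite ef (dG _ _ Gg); have := zE f fE; lia.
split; last by apply: contra_neqN za => /eqP gaa'; rewrite -gaa' -{2}gz (dG _ _ Gg).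
apply/fsetP => x; apply/imfsetP/idP => /= [[y yE ->]|xE].
  have : g y \in z |` E by rewrite (setwise_stable gF) FE yE orbT.
  rewrite FE => /predU1P[gyz|//].
  by case/negP: zNE; rewrite -(Sym_inj (etrans gyz (esym gz))).
have [y yF xy] : exists2 y, y \in z |` E & x = g y.
  by apply: setwise_preim => //; rewrite FE xE orbT.
exists y => //; move: yF; rewrite FE => /predU1P[yz|//].
by rewrite xy yz gz (negbTE zNE) in xE.
Qed.

End InfiniteDiameter.

Lemma gball_finite (D : rel X) n x :
  (forall y, finite_set [set z | D y z]%classic) ->
  finite_set [set y | gball D n x y]%classic.
Proof.
move=> finD; elim: n x => [|n IH] x.
  by apply: sub_finite_set (finite_set1 x) => y /= ->.
apply: (@sub_finite_set _ _
  ([set y | gball D n x y] `|`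
   \bigcup_(z in [set z | D x z]) [set y | gball D n z y])%classic).
  by move=> y /= [|[z]]; [left|right; exists z].
by rewrite finite_setU; split=> //; apply: bigcup_finite.
Qed.

(** * Finite separating sets force an orbital graph of infinite diameter *)

Section FiniteSeparation.
Variable R : rel X.
Hypothesis symR : symmetric R.

Let sepbound K x y :=
  forall s : seq X, uniq s -> {subset s <= sepset R x y} -> (size s <= K)%N.

Let sepboundD K L x y z :
  sepbound K x y -> sepbound L y z -> sepbound (K + L) x z.
Proof.
move=> xy yz s us sS; rewrite -(count_predC (fun w => R w x != R w y)) -!size_filter.
apply: leq_add.
  by apply: xy; rewrite ?filter_uniq// => w; rewrite mem_filter inE => /andP[].
apply: yz; rewrite ?filter_uniq// => w.
rewrite mem_filter => /andP[/negPn/eqP wxy /sS].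
by rewrite !inE /sepset/= wxy.
Qed.

(** Suppose all orbital graphs have finite diameter. They are not locally finite, so [u] has
    infinitely many neighbours and non-neighbours. Adjacent points are separated by at most [K]
    points, hence any two by at most [n * K]. A point adjacent neither to [u] nor to any of more
    than [n * K] neighbours of [u] contradicts this. *)
Lemma finite_separation_unbounded u v u' v' :
  rel_invariant G R -> u != v -> u' != v' -> ~~ R u' v' ->
  (forall x y, R x y = orbital u v x y) ->
  (forall x y, finite_set (sepset R x y)) ->
  exists a b, a != b /\ forall n, exists x y, ~ gball (orbital a b) n x y.
Proof.
move=> invR uv u'v' nR RE fin; apply: contrapT => no.
have bd a b : a != b -> exists n, forall x y, gball (orbital a b) n x y.
  move=> ab; apply: contrapT => nobd; apply: no; exists a, b; split=> // n.
  apply: contrapT => nob; apply: nobd; exists n => x y; apply: contrapT => nxy.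
  by apply: nob; exists x, y.
have nbr_inf a b o : a != b -> infinite_set [set z | orbital a b o z]%classic.
  move=> ab fino; have [n nP] := bd a b ab.
  apply: infX; apply: (@sub_finite_set _ _ [set y | gball (orbital a b) n o y]%classic).
    by move=> y _; exact: nP.
  apply: gball_finite => y; have [g Gg <-] := primitive_transitive o y infX pG prim.
  apply: sub_finite_set (finite_image g fino) => z /= oz; exists (Sym_inv g z).
    by rewrite /= -(orbital_invariant a b Gg) Sym_invVK.
  exact: Sym_invVK.
have Pinf : infinite_set [set z | R u z]%classic.
  apply: sub_infinite_set (nbr_inf u v u uv) => z /=; by rewrite RE.
(* By invariance, no edge of the orbital graph of [u'] and [v'] is an edge of [R]. *)
have Qinf : infinite_set [set z | ~~ R u z]%classic.
  apply: sub_infinite_set (nbr_inf u' v' u u'v') => z /= /asboolP[g Gg guv].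
  by case: guv => -[<- <-]; rewrite invR// symR.
have [n nP] := bd u v uv.
pose K := #|` fset_set (sepset R u v)|.
have Kuv : sepbound K u v.
  move=> s us sS; apply: uniq_leq_size => // x /sS xs.
  by rewrite in_fset_set.
have KD x y : orbital u v x y -> sepbound K x y.
  move=> /asboolP[g Gg guv] s us sS.
  have sepE : sepset R x y = [set g x | x in sepset R u v]%classic.
    by rewrite -(sepset_img _ _ pG invR Gg); case: guv => -[-> ->] //; rewrite sepset_sym.
  rewrite -[leqRHS](size_map g); apply: uniq_leq_size => // w /sS.
  rewrite sepE inE => -[z zs <-]; apply: map_f.
  by rewrite in_fset_set// inE.
have Kball m x y : gball (orbital u v) m x y -> sepbound (m * K) x y.
  elim: m x => [x <- s us sS|m IH x [/IH xy|[z /KD xz /IH zy]]].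
  - case: s sS {us} => // w s /(_ w (mem_head _ _)).
    by rewrite inE /sepset/= eqxx.
  - by move=> s us /(xy s us) /leq_trans; apply; rewrite leq_mul2r leqnSn orbT.
  - by rewrite mulSn; exact: sepboundD zy.
have [B BP cardB] := infinite_set_fset (n * K).+1 Pinf.
(* Outside the finite set [N], a non-neighbour of [u] is a non-neighbour of all points of [B]. *)
pose N := (\bigcup_(p in [set` B]) sepset R u p)%classic.
have Nfin : finite_set N by apply: bigcup_finite => //; exact: finite_fset.
have [q [/= nuq qN]] := infinite_setN0 (infinite_setD Qinf Nfin).
have /Kball/(_ (enum_fset B)) := nP u q; rewrite fset_uniq leqNgt cardB.
move=> /(_ isT) sB; suff /sB : {subset B <= sepset R u q} by [].
move=> p pB; have up := BP p pB; rewrite inE /sepset/= symR up.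
rewrite symR; apply/negP => /eqP pq; apply: qN; exists p => //.
by rewrite /sepset/= symR (negbTE nuq) -pq.
Qed.

End FiniteSeparation.

End Orbitals.

(** * Extensions without twins *)

Section TwinFreeExtension.
Local Open Scope fset_scope.
Variables (X : choiceType) (G : set (Sym X)) (R : rel X).
Hypotheses (pG : permutation_group G) (invR : rel_invariant G R).
Hypothesis infX : infinite_set [set: X]%classic.
Hypothesis transG : forall x y, exists2 g, G g & g x = y.
Hypotheses (symR : symmetric R).
Hypothesis sepR : forall a b, a != b -> infinite_set (sepset R a b).
Implicit Types (A C E F : {fset X}) (a b c w x y z : X).

Definition separates z a c := [&& z != a, z != c & R z a != R z c].

Definition twin E a c :=
  all (fun w => [|| w == a, w == c | R w a == R w c]) (enum_fset E).

Lemma twinP E a c :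
  reflect (forall w, w \in E -> w != a -> w != c -> R w a = R w c) (twin E a c).
Proof.
apply: (iffP allP) => tw w wE.
  by move=> wa wc; have := tw w wE; rewrite (negbTE wa) (negbTE wc) => /eqP.
have [//|wa] := eqVneq w a; have [//|wc] := eqVneq w c; apply/eqP.
exact: tw.
Qed.

Lemma separates_ex A a c : a != c -> exists2 z, separates z a c & z \notin A.
Proof.
move=> ac; have [z zac] := infinite_fresh (a |` (c |` A)) (sepR ac).
rewrite !in_fset1U !negb_or => /and3P[za zc zA].
by exists z => //; rewrite /separates za zc.
Qed.

(* Call [z] good for [(a, c)] if it separates them and relates to [a] as [c]
   does; adding a good [z] to a set in which [a] and [c] are twins creates no
   new twin of [a]. If no separator of [(a, c)] is good, transport one such
   separator [z] to [a] by the group: the image of [a] contradicts badness of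
   all the pairs [(a, z)]. *)
Lemma good_separator a c : a != c ->
  (exists2 z, separates z a c & R z a = R a c) \/
  (exists z z', [/\ separates z a c, separates z' a z & R z' a = R a z]).
Proof.
move=> ac; apply: contrapT => /not_orP[nogood nobad].
have neq_negb (b1 b2 : bool) : b1 <> b2 -> b1 = ~~ b2 by case: b1 b2 => [] [].
have bad z y : separates z a c -> separates y a z -> R y a = ~~ R a z.
  move=> zac yaz; apply: neq_negb => e; apply: nobad; by exists z, y.
have bad1 z : separates z a c -> R z a = ~~ R a c.
  by move=> zac; apply: neq_negb => e; apply: nogood; exists z.
have [z zac _] := separates_ex fset0 ac.
have Rza := bad1 z zac; have [za zc _] := and3P zac.
have [g Gg gz] := transG z a; pose z' := g a.
have Rz'a : R z' a = ~~ R a c by rewrite -{1}gz invR// symR.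
have z'a : z' != a by rewrite -{1}gz /z' (inj_eq (@Sym_inj _ g)) eq_sym.
(* The image of [(a, z)] under [g] is [(z', a)], so badness of [(a, z)] carries over to separators
   of [z'] and [a]. *)
have bad' y : y != z' -> y != a -> R y z' != R y a -> R y z' = R a c.
  move=> yz' ya yz'a; have gy := Sym_invVK g y.
  have := bad z (Sym_inv g y) zac; rewrite -[LHS](invR Gg) gy -/z' [R a z]symR Rza negbK.
  apply; rewrite /separates -(inj_eq (@Sym_inj _ g)) gy yz'.
  rewrite -(inj_eq (@Sym_inj _ g)) gy gz ya /=.
  by rewrite -(invR Gg (Sym_inv g y) a) -(invR Gg _ z) gy gz.
have z'c : z' != c.
  by apply: contra_eq_neq Rz'a => ->; rewrite symR; case: (R a c).
have Rcz' : R c z' = R a c.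
  have [e|/negPf] := eqVneq (R c z') (R c a); first by rewrite e symR.
  by move=> /negbT /(bad' c _ _); apply; rewrite eq_sym.
have z'ac : separates z' a c.
  by rewrite /separates z'a z'c Rz'a [R z' c]symR Rcz'; case: (R a c).
have az' : a != z' by rewrite eq_sym.
have [y yaz' _] := separates_ex fset0 az'.
have /and3P[ya yz' Rya] := yaz'.
(* As [z'] also separates [a] and [c], badness of [(a, z')] forces [R y a = R a c], which is
   [R y z'] as well. *)
have := bad z' y z'ac yaz'; rewrite [R a z']symR Rz'a negbK => e.
by move: (Rya); rewrite e bad' ?eqxx// eq_sym.
Qed.

Let twins A C := [fset p in A `*` C | twin (A `|` C) p.1 p.2].

(** For [a'] in [A] other than [a], a twin [z] of [a'] would relate to [a] and [c] as [a'] does,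
    that is, equally. If [R z a = R a c], a twin [z] of [a] would have [R z c = R a c = R z a]. *)
Lemma twin_add A C a c z : {in C, forall x, x \notin A} ->
  (a, c) \in twins A C -> separates z a c ->
  [/\ z \notin A `|` C,
      twins A (z |` C) `<=` (a, z) |` (twins A C `\ (a, c))
    & R z a = R a c -> (a, z) \notin twins A (z |` C)].
Proof.
move=> CA actw /and3P[za zc sep].
have [aA cC tw] : [/\ a \in A, c \in C & twin (A `|` C) a c].
  by move: actw; rewrite !inE => /andP[/andP[]].
move/twinP in tw.
have zAC : z \notin A `|` C.
  by apply: contraNN sep => zAC; apply/eqP/tw.
have inU w : w \in A `|` C -> w \in A `|` (z |` C).
  by rewrite !inE => /orP[->|->]; rewrite ?orbT.
have aU : a \in A `|` C by rewrite inE aA.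
have cU : c \in A `|` C by rewrite inE cC orbT.
have ac : a != c by apply: contraTneq aA => ->; exact: CA.
split=> //.
  apply/fsubsetP => -[a' c']; rewrite !inE/= => /andP[/andP[a'A c'zC] /twinP tw'].
  have a'U : a' \in A `|` C by rewrite inE a'A.
  have [e|c'z] := eqVneq c' z; last first.
    rewrite (negbTE c'z) /= in c'zC; rewrite xpair_eqE (negbTE c'z) andbF /=.
    rewrite a'A c'zC /=; apply/andP; split.
      apply: contraNneq sep => -[ea ec]; rewrite -ea -ec; apply/eqP/tw'.
      - by rewrite !inE eqxx orbT.
      - by rewrite ea.
      - by rewrite ec.
    by apply/twinP => w wU; apply: tw'; exact: inU.
  rewrite e in tw' *; have [->|a'a] := eqVneq a' a; first by rewrite eqxx.
  have a'c : a' != c by apply: contraTneq a'A => ->; exact: CA.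
  have za' : z != a' by apply: contraNneq zAC => ->.
  case/eqP: sep; rewrite [LHS]symR [RHS]symR.
  rewrite -(tw' a (inU _ aU) _ _) 1?eq_sym// -(tw' c (inU _ cU) _ _) 1?eq_sym//.
  by rewrite symR (tw a' a'U)// symR.
move=> Rza; rewrite !inE/= aA eqxx /=; apply/twinP => tw'.
case/eqP: sep; rewrite Rza [RHS]symR -(tw' c (inU _ cU)) 1?eq_sym//.
Qed.

(** Starting from separators of all pairs of points of [A], the number of twin pairs between [A] and
    [C] is brought down to zero. A good separator removes a pair and creates none. *)
Lemma twin_free_extension A : exists C,
  [/\ {in C, forall c, c \notin A},
      forall a a', a \in A -> a' \in A -> a != a' ->
        exists2 c, c \in C & R c a != R c a'
    & forall a c, a \in A -> c \in C ->
        exists2 w, w \in A `|` C & separates w a c].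
Proof.
have sepf (p : X * X) : exists z, z \notin A /\ (p.1 != p.2 -> R z p.1 != R z p.2).
  have [->|p12] := eqVneq p.1 p.2.
    have [x _ xA] := infinite_fresh A infX.
    by exists x.
  have [z /and3P[_ _ sz] zA] := separates_ex A p12; by exists z.
have [f fP] := choice sepf.
pose C0 := f @` (A `*` A).
have C0A : {in C0, forall c, c \notin A}.
  by move=> _ /imfsetP[p _ ->]; have [] := fP p.
have [C [C0C CA /eqP twC]] : exists C,
    [/\ C0 `<=` C, {in C, forall c, c \notin A} & #|` twins A C| == 0].
  have [n] := ubnP #|` twins A C0|; move: C0 C0A.
  elim: n => // n IH C CA; rewrite ltnS => twn.
  have [tw0|] := boolP (#|` twins A C| == 0); first by exists C.
  rewrite cardfs_eq0 => /fset0Pn[[a c] actw].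
  have ac : a != c.
    move: (actw); rewrite !inE /= => /andP[/andP[aA cC] _].
    by apply: contraTneq aA => ->; exact: CA.
  suff [C' [CC' C'A twC']] : exists C', [/\ C `<=` C', {in C', forall c, c \notin A}
      & twins A C' `<=` twins A C `\ (a, c)].
    have lt : (#|` twins A C'| < n)%N.
      apply: leq_trans twn; apply: fproper_ltn_card.
      exact: fsub_proper_trans twC' (fproperD1 actw).
    have [C'' [C'C'' C''A tw0]] := IH C' C'A lt.
    by exists C''; split=> //; exact: fsubset_trans C'C''.
  have addA z C1 : z \notin A `|` C1 -> {in C1, forall c, c \notin A} ->
      {in z |` C1, forall c, c \notin A}.
    move=> zAC C1A x; rewrite in_fset1U => /predU1P[->|/C1A//].
    by apply: contra zAC; rewrite inE => ->.
  have drop C1 B (p : X * X) : p \notin twins A C1 -> twins A C1 `<=` p |` B ->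
      twins A C1 `<=` B.
    move=> pC /fsubsetP sub; apply/fsubsetP => q qC; have := sub q qC.
    by rewrite in_fset1U => /predU1P[qp|//]; rewrite qp (negbTE pC) in qC.
  have [[z zac Rza]|[z [z' [zac z'az Rz'a]]]] := good_separator ac.
    have [zAC sub /(_ Rza) good] := twin_add CA actw zac.
    exists (z |` C); split; [exact: fsubsetU1 | exact: addA | exact: drop good sub].
  have [zAC sub _] := twin_add CA actw zac; have zCA := addA _ _ zAC CA.
  (* The point [z] may create the twin pair [(a, z)]; then [z'], good for it, removes it again. *)
  have [azt|azt] := boolP ((a, z) \in twins A (z |` C)); last first.
    exists (z |` C); split=> //; [exact: fsubsetU1 | exact: drop azt sub].
  have [z'AC sub' /(_ Rz'a) good] := twin_add zCA azt z'az.
  exists (z' |` (z |` C)); split.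
  - exact: fsubset_trans (fsubsetU1 _ _) (fsubsetU1 _ _).
  - exact: addA.
  - apply: fsubset_trans (drop _ _ _ good sub') _ => //.
    apply/fsubsetP => q; rewrite in_fsetD1 => /andP[qaz /(fsubsetP sub)].
    by rewrite in_fset1U (negbTE qaz).
exists C; split=> // [a a' aA a'A aa'|a c aA cC].
  exists (f (a, a')); last by have [_] := fP (a, a'); apply.
  by apply: (fsubsetP C0C); apply/imfsetP; exists (a, a') => //; rewrite inE/= aA.
have ntw : ~~ twin (A `|` C) a c.
  apply: contra_eqN twC => tw; rewrite cardfs_eq0; apply/fset0Pn.
  by exists (a, c); rewrite !inE/= aA cC.
move: ntw => /allPn[w wU]; rewrite !negb_or => sw; by exists w.
Qed.

End TwinFreeExtension.

(** * Blocks of twins *)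

Lemma in_sep (X : choiceType) (A : {fset X}) (p : X -> bool) x :
  (x \in [fset y in A | p y])%fset = (x \in A) && p x.
Proof. by rewrite !inE. Qed.

Section Blocks.
Local Open Scope fset_scope.
Variables (X : choiceType) (R : rel X).
Hypothesis symR : symmetric R.
Variables (U : nat -> set_system X) (K : nat) (E : {fset X}).
Hypothesis freeU : forall i, free_ultra (U i).

(* The relation between the blocks of [U i] and [U j] when the latter is chosen
   later: the iterated limits need not commute. *)
Definition kappa i j := ulim (U i) (xi R (U j)).

(** [col] numbers the blocks in order of choice. Limits along all [K] ultrafilters are prescribed so
    that later blocks relate uniformly to earlier ones. Each block outnumbers [E] and the earlier
    blocks together. *)
Definition block_system (F : {fset X}) (col : X -> nat) (k : nat) :=
  [/\ E `<=` F,
      forall x, x \in F `\` E ->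
        [/\ col x < k, forall w, w \in E -> R x w = xi R (U (col x)) w
          & forall j, j < K -> xi R (U j) x = kappa (col x) j],
      forall x y, x \in F `\` E -> y \in F `\` E -> x != y ->
        R x y = kappa (minn (col x) (col y)) (maxn (col x) (col y))
    & forall i, i < k -> #|` E| + #|` [fset x in F `\` E | col x < i]|
                         < #|` [fset x in F `\` E | col x == i]|].

(** The new block is a generic chain for [U k] over all of [F], so its relation to an earlier block
    point [y] is [xi R (U k) y], which was prescribed when [y] was chosen. *)
Lemma block_system_ex k : k <= K -> exists F col, block_system F col k.
Proof.
elim: k => [_|k IH kK].
  exists E, (fun=> 0); split=> // x; first by rewrite fsetDv.
  by move=> y; rewrite fsetDv.
have [F [col [EF colF RF cardF]]] := IH (ltnW kK).
pose P := [set x | forall j, j \in iota 0 K -> xi R (U j) x = kappa k j]%classic.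
have [ultUk _] := freeU k; have PU := @ultra_proper _ _ ultUk.
have UkP : U k P.
  apply: (@filter_seq _ _ (U k) _ (fun j => [set x | xi R (U j) x = kappa k j])%classic).
  by move=> j _; exact: ulimP.
(* [F] consists of [E] and the earlier blocks, hence the length. *)
have [s [us sz sP pw]] := ultra_chain R F #|` F|.+1 (freeU k) UkP.
pose F' := F `|` seq_fset tt s.
pose col' x := if x \in s then k else col x.
have FE' x : (x \in F' `\` E) = (x \in F `\` E) || (x \in s).
  rewrite !in_fsetD in_fsetU seq_fsetE andb_orr; congr (_ || _).
  have [xs|] := boolP (x \in s); last by rewrite andbF.
  have [xF _ _ _] := sP x xs.
  by rewrite andbT; apply: contraNN xF; exact: (fsubsetP EF).
have FEs x : x \in F `\` E -> x \notin s.
  by rewrite in_fsetD => /andP[_ xF]; apply: contraL xF => /sP[].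
have col'F x : x \in F `\` E -> col' x = col x.
  by move=> /FEs; rewrite /col' => /negbTE ->.
have col's x : x \in s -> col' x = k by rewrite /col' => ->.
have Rs x y : x \in s -> y \in s -> x != y -> R x y = kappa k k.
  move=> xs ys xy.
  have : pairwise [rel x y | (x != y) && (R x y == kappa k k)] s.
    by rewrite pairwise_relI -uniq_pairwise us.
  move=> /(pairwiseP x) pws.
  have ltxy z t : z \in s -> t \in s -> index z s < index t s -> R z t = kappa k k.
    move=> zs ts zt; have := pws (index z s) (index t s).
    by rewrite !inE !index_mem !nth_index//= => /(_ zs ts zt) /andP[_ /eqP].
  have [/ltxy->//|/ltxy <-//|ixy] := ltngtP (index x s) (index y s).
  by move: xy; rewrite -(nth_index x xs) ixy nth_index// eqxx.
have RsF x y : x \in s -> y \in F `\` E -> R x y = kappa (col y) k.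
  move=> xs yF; have [_ _ _ ->] := sP x xs; last by move: yF; rewrite in_fsetD => /andP[].
  by have [_ _ ->] := colF y yF.
exists F', col'; split.
- exact: fsubset_trans EF (fsubsetUl _ _).
- move=> x; rewrite FE' => /orP[xF|xs].
    by rewrite col'F//; have [lt ? ?] := colF x xF; split=> //; exact: ltnW.
  rewrite col's//; have [_ Px _ Rx] := sP x xs; split=> // [w wE|j jK].
    by apply: Rx; exact: (fsubsetP EF).
  by apply: Px; rewrite mem_iota.
- move=> x y; rewrite !FE' => /orP[xF|xs] /orP[yF|ys] xy.
  + by rewrite !col'F//; exact: RF.
  + rewrite col'F// col's// symR RsF//; have [lt _ _] := colF x xF.
    by rewrite (minn_idPl _) ?(maxn_idPr _) ?(ltnW lt).
  + rewrite col's// col'F// RsF//; have [lt _ _] := colF y yF.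
    by rewrite (minn_idPr _) ?(maxn_idPl _) ?(ltnW lt).
  + by rewrite !col's// minnn maxnn; exact: Rs.
- move=> i; rewrite ltnS leq_eqVlt => /predU1P[->|ik].
    have -> : [fset x in F' `\` E | col' x < k] = F `\` E.
      apply/fsetP => x; rewrite in_sep FE'.
      have [xF|xF] := boolP (x \in F `\` E).
        by rewrite col'F//; have [] := colF x xF.
      by have [xs|//] := boolP (x \in s); rewrite col's// ltnn.
    have -> : [fset x in F' `\` E | col' x == k] = seq_fset tt s.
      apply/fsetP => x; rewrite in_sep FE' seq_fsetE.
      have [xs|xs] := boolP (x \in s); first by rewrite col's// eqxx orbT.
      rewrite orbF; apply/negP => /andP[xF]; rewrite col'F//.
      by have [+ _ _] := colF x xF; case: eqP => // ->; rewrite ltnn.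
    rewrite cardfsDS// subnKC ?fsubset_leq_card//.
    by rewrite size_seq_fset undup_id// sz.
  have old (q : pred nat) : ~~ q k ->
      [fset x in F' `\` E | q (col' x)] = [fset x in F `\` E | q (col x)].
    move=> nqk; apply/fsetP => x; rewrite !in_sep FE'.
    have [xF|xF] := boolP (x \in F `\` E); first by rewrite col'F.
    by have [xs|//] := boolP (x \in s); rewrite col's// (negbTE nqk).
  rewrite (old (fun j => j < i)) ?(old (fun j => j == i)) ?cardF//.
    by rewrite gtn_eqF.
  by rewrite -leqNgt ltnW.
Qed.

(** * Stability of twin classes under automorphisms *)

Section TwinClasses.
Variables (F : {fset X}) (g : Sym X).
Hypotheses (gF : g @` F = F) (gR : forall x y, R (g x) (g y) = R x y).

Lemma twin_sym x y : twin R F x y = twin R F y x.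
Proof. by apply/twinP/twinP => tw w wF wx wy; rewrite tw. Qed.

(** The critical witness is [w = y], where [R x y = R x z = R z x = R z y]. *)
Lemma twin_trans x y z : x \in F -> y \in F -> z \in F ->
  twin R F x y -> twin R F y z -> twin R F x z.
Proof.
move=> xF yF zF /twinP xy /twinP yz; apply/twinP => w wF wx wz.
have [wy|wy] := eqVneq w y; last by rewrite xy// yz.
have [<-//|xz] := eqVneq x z; rewrite {w}wy in wF wx wz *.
have xyz : R x y = R x z by apply: yz => //; rewrite eq_sym.
have zxy : R z x = R z y by apply: xy; rewrite // eq_sym.
by rewrite symR xyz symR zxy symR.
Qed.

Lemma twin_img x y : twin R F (g x) (g y) = twin R F x y.
Proof.
apply/twinP/twinP => tw w wF wx wy.
  by rewrite -(gR w x) -(gR w y) tw ?(setwise_stable gF)// (inj_eq (@Sym_inj _ g)).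
have [v vF wv] := setwise_preim gF wF; move: wx wy; rewrite wv !gR.
by rewrite !(inj_eq (@Sym_inj _ g)) => vx vy; exact: tw.
Qed.

(* The twin class of a block has more elements than all elements outside it
   and outside the classes of the larger blocks, which are stable already. *)
Lemma block_twin_stable col x : block_system F col K ->
  x \in F `\` E -> twin R F (g x) x.
Proof.
move=> [EF colF RF cardF].
have sub y : y \in F `\` E -> y \in F by rewrite in_fsetD => /andP[].
have same y z : y \in F `\` E -> z \in F `\` E -> col y = col z -> twin R F y z.
  move=> yF zF yz; apply/twinP => w wF wy wz.
  have [wE|wE] := boolP (w \in E).
    have [_ Ry _] := colF y yF; have [_ Rz _] := colF z zF.
    by rewrite symR Ry// symR Rz// yz.
  have wFE : w \in F `\` E by rewrite in_fsetD wE.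
  by rewrite !RF// yz.
(* Blocks are treated from the last and largest down. *)
have [n] := ubnP (K - col x); elim: n x => // n IH x; rewrite ltnS => xn xF.
have [xK _ _] := colF x xF; apply: contraT => ntw.
have gxF : g x \in F by rewrite (setwise_stable gF) sub.
have := card_filter_stable gF (p := fun y => twin R F y x)
  (q := fun y => twin R F y (g x)) (fun y _ => twin_img y x).
have le1 : #|` [fset y in F `\` E | col y == col x]| <=
    #|` [fset y in F | twin R F y x]|.
  apply/fsubset_leq_card/fsubsetP => y; rewrite !in_sep => /andP[yF /eqP yx].
  by rewrite sub//=; exact: same.
have le2 : #|` [fset y in F | twin R F y (g x)]| <=
    #|` E| + #|` [fset y in F `\` E | col y < col x]|.
  apply: leq_trans (_ : #|` E `|` [fset y in F `\` E | col y < col x]| <= _); last first.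
    by rewrite cardfsU leq_subr.
  apply/fsubset_leq_card/fsubsetP => y; rewrite in_fsetU !in_sep => /andP[yF tw].
  have [//|yE /=] := boolP (y \in E).
  have yFE : y \in F `\` E by rewrite in_fsetD yE.
  rewrite yFE /= ltnNge leq_eqVlt; apply: contra ntw => /predU1P[xy|xy].
    apply: twin_trans (same y x yFE xF (esym xy)) => //; first exact: sub.
    by rewrite twin_sym.
  (* A twin [y] of [g x] in a later block is a twin of [g y]; so [g y] and [g x] are twins, then [y]
     and [x], and finally [x] and [g x]. *)
  have tgy : twin R F (g y) y by apply: IH => //; lia.
  have gyF : g y \in F by rewrite (setwise_stable gF).
  have : twin R F (g y) (g x) by exact: twin_trans tgy tw.
  rewrite twin_img twin_sym => yx; rewrite twin_sym in tw.
  by rewrite twin_sym; apply: twin_trans yx _ => //; [exact: sub|rewrite twin_sym].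
by have := cardF _ xK; lia.
Qed.

(** If [g a] were in a block, it would be a twin of its image, hence of [a], which the first
    condition excludes. If [g a] were another point of [E], a block point [b] would tell it from
    [a], although [R b a = R (g b) (g a) = R b (g a)]. *)
Lemma block_system_fixes col (A : {fset X}) : block_system F col K -> A `<=` E ->
  (forall a i, a \in A -> i < K ->
     (exists2 w, w \in E & (w != a) && (xi R (U i) w != R w a)) \/
     (exists j, [/\ j < K, j != i, kappa i j = kappa j i
                 & xi R (U j) a != kappa i j])) ->
  (forall a e, a \in A -> e \in E -> e != a ->
     exists2 i, i < K & xi R (U i) a != xi R (U i) e) ->
  {in A, forall a, g a = a}.
Proof.
move=> bs /fsubsetP AE ntwin sep a aA; have [EF colF RF cardF] := bs.
have sub y : y \in F `\` E -> y \in F by rewrite in_fsetD => /andP[].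
have nE y : y \in F `\` E -> y \notin E by rewrite in_fsetD => /andP[].
have aE := AE a aA; have aF := fsubsetP EF a aE.
have block_ex i : i < K -> exists2 b, b \in F `\` E & col b = i.
  move=> iK; have := leq_ltn_trans (leq0n _) (cardF i iK).
  rewrite cardfs_gt0 => /fset0Pn[b]; rewrite in_sep => /andP[bF /eqP bi].
  by exists b.
have nea x w : x \in F `\` E -> w \in E -> w != x.
  by move=> xF wE; apply: contraTneq wE => ->; exact: nE.
have ntw x : x \in F `\` E -> ~~ twin R F a x.
  move=> xF; apply/negP => /twinP tw; have [xK Rx _] := colF x xF.
  case: (ntwin a (col x) aA xK) => [[w wE /andP[wa]]|[j [jK jx kij]]].
    by rewrite -Rx// symR tw ?eqxx//; [exact: (fsubsetP EF)|exact: nea].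
  have [b bF bj] := block_ex j jK; have [_ Rb _] := colF b bF.
  rewrite -bj -Rb//; have bx : b != x by apply: contraNneq jx => <-; rewrite bj.
  rewrite tw ?sub// 1?eq_sym 1?nea// RF// bj.
  (* The two iterated limits agree, so it is immaterial which block was chosen first. *)
  rewrite /minn /maxn; case: ltnP => _; rewrite -?kij ?eqxx//.
have gaF : g a \in F by rewrite (setwise_stable gF).
have gaE : g a \in E.
  apply: contraT => gaE; have gaFE : g a \in F `\` E by rewrite in_fsetD gaE.
  have := block_twin_stable bs gaFE; rewrite twin_img twin_sym => tw.
  by have := ntw _ gaFE; rewrite tw.
apply/eqP; apply: contraT => gaa.
have [i iK] := sep a (g a) aA gaE gaa.
have [b bF bi] := block_ex i iK; have [_ Rb _] := colF b bF.
rewrite -bi -!Rb//; have /twinP tw := block_twin_stable bs bF.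
rewrite -(gR b a) symR tw ?[R (g a) b]symR ?eqxx//; last exact: nea.
by rewrite (inj_eq (@Sym_inj _ g)) nea.
Qed.

End TwinClasses.

End Blocks.

(** * Graphs whose neighbourhoods differ infinitely *)

Section InfiniteSeparation.
Local Open Scope fset_scope.
Variables (X : choiceType) (G : set (Sym X)) (R : rel X).
Hypotheses (infX : infinite_set [set: X]%classic) (pG : permutation_group G).
Hypotheses (prim : primitive G) (invR : rel_invariant G R) (symR : symmetric R).
Hypothesis sepR : forall a b, a != b -> infinite_set (sepset R a b).
Implicit Types (A C E F W : {fset X}) (a b c w x y z : X).

(* The neighbourhoods, read off at the points of [W], tell [a] from all other
   points outside [W]. *)
Definition isolates W a :=
  forall x, x \notin W -> x != a -> exists2 w, w \in W & w != a /\ R x w != R a w.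

Lemma isolates_img g W a : G g -> isolates W a -> isolates (g @` W) (g a).
Proof.
move=> Gg iso x xW xa; have gx := Sym_invVK g x.
have [||w wW [wa xw]] := iso (Sym_inv g x).
- by apply: contra xW => xW; apply/imfsetP; exists (Sym_inv g x).
- by apply: contra_neq xa => <-.
exists (g w); first by apply/imfsetP; exists w.
by rewrite (inj_eq (@Sym_inj _ g)) wa -gx !invR.
Qed.

(** By transitivity every [a] in [A] is isolated by some [V a], and these sets go into [E]. A point
    generic for any [U i] lies outside [V a], so a point of [V a] prevents it from being a twin of
    [a]. *)
Lemma isolated_locally_rigid c W : isolates W c -> locally_rigid G.
Proof.
move=> isoc A.
have isoG a : exists Wa, isolates Wa a.
  have [g Gg <-] := primitive_transitive c a infX pG prim.
  by exists (g @` W); exact: isolates_img.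
have [V isoV] := choice isoG.
pose E := A `|` seq_fset tt (flatten [seq enum_fset (V a) | a <- enum_fset A]).
have VE a w : a \in A -> w \in V a -> w \in E.
  move=> aA wV; rewrite in_fsetU seq_fsetE; apply/orP; right.
  by apply/flattenP; exists (enum_fset (V a)) => //; exact: map_f.
(* Equal pairs receive an arbitrary free ultrafilter; they also occur as the default [(c, c)] beyond
   the end of [L]. *)
have sepU (p : X * X) :
    exists U, free_ultra U /\ (p.1 != p.2 -> U (sepset R p.1 p.2)).
  have [e|p12] := eqVneq p.1 p.2.
    by have [U freeU _] := free_ultra_infinite infX; exists U.
  by have [U freeU Up] := free_ultra_infinite (sepR p12); exists U.
have [f fP] := choice sepU.
pose L := [seq (a, e) | a <- enum_fset A, e <- enum_fset E].
pose U i := f (nth (c, c) L i).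
have freeU i : free_ultra (U i) by have [] := fP (nth (c, c) L i).
have [F [col bs]] := block_system_ex symR E freeU (leqnn (size L)).
have AE : A `<=` E by exact: fsubsetUl.
exists F => [|g Gg gF]; first by case: bs => EF _ _ _; exact: fsubset_trans EF.
have [ultU _] := freeU 0%N.
apply: (block_system_fixes symR gF (invR Gg) bs AE) => [a i aA _|a e aA eE ea].
  left; have [{}ultU fU] := freeU i; have PU := @ultra_proper _ _ ultU.
  apply: contrapT => no.
  have UR : U i [set x | forall w, w \in enum_fset (V a) -> R x w = xi R (U i) w]%classic.
    apply: (@filter_seq _ _ _ _ (fun w => [set x | R x w = xi R (U i) w])%classic).
    by move=> w _; exact: ulimP.
  have [x [xR xV]] := filter_ex (filterI UR (fU (a |` V a))).
  move: xV; rewrite /= in_fset1U negb_or => /andP[xa xV].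
  have [w wV [wa xw]] := isoV a x xV xa; apply: no; exists w; first exact: VE wV.
  by rewrite wa -xR// [R w a]symR.
have aeL : (a, e) \in L by exact: allpairs_f.
exists (index (a, e) L); first by rewrite index_mem.
rewrite /U nth_index//; have [[{}ultU _]] := fP (a, e).
by rewrite /= eq_sym ea => /(_ isT); exact: xi_sepset.
Qed.

(** Without isolation, the points outside a finite set [W] that agree with [c] on [W] generate a
    proper filter; an ultrafilter above it converges to the neighbourhood of [c], apart from the
    coordinate [c]. *)
Lemma ultra_near c : (forall W, ~ isolates W c) -> exists U, free_ultra U /\
  forall w, w != c -> U [set x | R x w = R c w]%classic.
Proof.
move=> niso.
pose B W := [set x | [/\ x \notin W, x != c &
  forall w, w \in W -> w != c -> R x w = R c w]]%classic.
pose Phi : set_system X := filter_from [set: {fset X}]%classic B.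
have PhiF : ProperFilter Phi.
  apply: filter_from_proper; first last.
    move=> W _; apply: contrapT => nB; apply: (niso W) => x xW xc.
    apply: contrapT => now; apply: nB; exists x; split=> // w wW wc.
    by apply/eqP/negPn/negP => xw; apply: now; exists w.
  apply: filter_from_filter; first by exists fset0.
  move=> W W' _ _; exists (W `|` W') => // x [].
  rewrite in_fsetU negb_or => /andP[xW xW'] xc RW.
  by split; split=> // w wW; apply: RW; rewrite in_fsetU wW ?orbT.
have [U [ultU PhiU]] := ultraFilterLemma PhiF.
exists U; split; first split=> //.
  by move=> A; apply: PhiU; exists A => // x [].
move=> w wc; apply: PhiU; exists [fset w] => // x [_ _]; apply=> //.
by rewrite in_fset1.
Qed.

(** A block from an ultrafilter converging to a point of [C] behaves like that point: limits become
    values of [R], and the properties of [C] become the conditions of [block_system_fixes] with [E]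
    equal to [A]. *)
Lemma perfect_locally_rigid : (forall c W, ~ isolates W c) -> locally_rigid G.
Proof.
move=> niso A.
have [f fP] := choice (fun c => ultra_near (niso c)).
have xif c w : w != c -> xi R (f c) w = R c w.
  by move=> wc; have [[ultU _] near] := fP c; exact: ulim_eq (near w wc).
have [x0 _ _] := infinite_fresh A infX.
have transG x y := primitive_transitive x y infX pG prim.
have [C [CA sepC twC]] := twin_free_extension invR infX transG symR sepR A.
pose U i := f (nth x0 (enum_fset C) i).
have freeU i : free_ultra (U i) by have [] := fP (nth x0 (enum_fset C) i).
have [F [col bs]] := block_system_ex symR A freeU (leqnn #|` C|).
exists F => [|g Gg gF]; first by case: bs.
(* Hence the iterated limits commute for distinct points of [C], by symmetry of [R]. *)
have kapE c d : d != c -> ulim (f c) (xi R (f d)) = R c d.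
  move=> dc; have [[ultU free] near] := fP c; have PU := @ultra_proper _ _ ultU.
  apply: ulim_eq => //; apply: filterS (filterI (free [fset d]) (near d dc)).
  move=> x [] /=; rewrite in_fset1 => xd xR.
  by rewrite xif// symR.
apply: (block_system_fixes symR gF (invR Gg) bs (fsubset_refl _)) => [a i aA iC|a e aA eA ea].
  set c := nth x0 (enum_fset C) i; have cC : c \in C by exact: mem_nth.
  have [w wAC /and3P[wa wc sw]] := twC a c aA cC.
  move: wAC; rewrite in_fsetU => /orP[wA|wC].
    left; exists w => //; rewrite wa /U xif//.
    by rewrite [R c w]symR eq_sym.
  right; exists (index w (enum_fset C)); rewrite index_mem; split=> //.
  - by apply: contra_neq wc => e; rewrite /c -e nth_index.
  - by rewrite /kappa /U nth_index// -/c !kapE// eq_sym.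
  rewrite /kappa /U nth_index// -/c kapE// xif; first by rewrite [R c w]symR.
  by apply: contraTneq aA => ->; exact: CA.
have ae : a != e by rewrite eq_sym.
have [c cC sc] := sepC a e aA eA ae.
exists (index c (enum_fset C)); first by rewrite index_mem.
have nA x : x \in A -> x != c by move=> xA; apply: contraTneq xA => ->; exact: CA.
by rewrite /U nth_index// !xif// nA.
Qed.

Lemma infinite_separation_locally_rigid : locally_rigid G.
Proof.
have [[W [c iso]]|no] := pselect (exists W c, isolates W c).
  exact: isolated_locally_rigid iso.
by apply: perfect_locally_rigid => c W iso; apply: no; exists W, c.
Qed.

End InfiniteSeparation.

(** * Primitive groups that are not 2-transitive *)

Section Main.
Variables (X : choiceType) (G : set (Sym X)).
Hypotheses (infX : infinite_set [set: X]%classic) (pG : permutation_group G).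
Hypothesis prim : primitive G.

Lemma primitive_locally_rigid : ~ two_transitive G -> locally_rigid G.
Proof.
move=> n2t.
have [x1 [x2 [y1 [y2 [x12 y12 n12]]]]] : exists x1 x2 y1 y2 : X,
    [/\ x1 != x2, y1 != y2 & forall g, G g -> g x1 = y1 -> g x2 = y2 -> False].
  apply: contrapT => no; apply: n2t => x1 x2 y1 y2 /eqP x12 /eqP y12.
  apply: contrapT => nog; apply: no; exists x1, x2, y1, y2; split=> // g Gg g1 g2.
  by apply: nog; exists g.
have [hom|nhom] := pselect (forall a b c d : X, a != b -> c != d ->
    exists2 g, G g & (g a = c /\ g b = d) \/ (g a = d /\ g b = c)).
  (* The orbit of the ordered pair [(x1, x2)] is a tournament, total by 2-homogeneity. *)
  pose R : rel X := fun x y => `[< exists2 g, G g & g x1 = x /\ g x2 = y >].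
  apply: (@tournament_locally_rigid _ _ R) => //.
  - apply: rel_invariantW => // g Gg x y /asboolP[h Gh [<- <-]]; apply/asboolP.
    by exists (Sym_mul g h) => //; exact: pgroupM.
  - move=> x; apply/asboolP => -[g _ [<- /Sym_inj]].
    by move=> e; rewrite e eqxx in x12.
  - move=> x y /andP[/asboolP[g Gg [gx gy]] /asboolP[h Gh [hy hx]]].
    (* If [k] takes [(x1, x2)] to [(y2, y1)], the swap of [x1] and [x2] followed by [k] takes
       [(x1, x2)] to [(y1, y2)], which was excluded. *)
    have [k Gk [[k1 k2]|[k1 k2]]] := hom x1 x2 y1 y2 x12 y12.
      by case: (n12 k).
    case: (n12 (Sym_mul k (Sym_mul (Sym_inv g) h))).
    + by apply: pgroupM => //; apply: pgroupM => //; exact: pgroupV.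
    + by rewrite -k2; congr (k _); rewrite -[RHS](Sym_invK g) gy -hy.
    + by rewrite -k1; congr (k _); rewrite -[RHS](Sym_invK g) gx -hx.
  - move=> x y xy; have [g Gg [[gx gy]|[gy gx]]] := hom x1 x2 x y x12 xy.
      by apply/orP; left; apply/asboolP; exists g.
    by apply/orP; right; apply/asboolP; exists g.
(* Otherwise some orbital graph is not complete. *)
have [a [b [c [d [ab cd nab]]]]] : exists a b c d : X,
    [/\ a != b, c != d & ~~ orbital G a b c d].
  apply: contrapT => no; apply: nhom => a b c d ab cd.
  apply: contrapT => nog; apply: no; exists a, b, c, d; split=> //.
  by apply/asboolP.
have symR := @orbital_sym _ G a b; have invR := orbital_invariant pG a b.
have [sepR|fin] := sepset_dichotomy pG prim invR.
  exact: infinite_separation_locally_rigid sepR.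
have [u [v [uv unb]]] := finite_separation_unbounded infX pG prim symR invR ab cd
  nab (fun x y => erefl) fin.
exact: infinite_diameter_locally_rigid unb.
Qed.

End Main.

Local Open Scope classical_set_scope.

Theorem theorem1p1 (X : choiceType) (G H : set (Sym X)) :
  infinite_set [set: X] ->
  permutation_group G -> closed G ->
  permutation_group H -> closed H ->
  H `<=` G ->
  orbit_equivalent G H ->
  primitive G ->
  ~ two_transitive G ->
  H = G.
Proof.
move=> infX pG _ pH clH HG GH prim n2t.
exact: locally_rigid_eq (primitive_locally_rigid infX pG prim n2t).
Qed.
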